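(* Let $\alpha\in(0,1)$, $p\in(0,1]$ and $m=\lfloor\alpha n\rfloor$. There exist constants $\rho^*(\alpha,p)>0$ and $c_{11}>0$ such that for all sufficiently large $n$, with probability at least $1-e^{-c_{11}n}$, an $m\times n$ matrix $A$ with i.i.d. $\mathcal N(0,1)$ entries has the property: every $\mathbf x\in\mathbb R^n$ with at most $\rho^*(\alpha,p)n$ nonzero entries is the unique solution of $\min\{\|\mathbf v\|_p^p:A\mathbf v=A\mathbf x\}$.
   Context: $\|\mathbf v\|_p^p=\sum_i|v_i|^p$. *)

(* Defs.v *)
From HB Require Import structures.
From mathcomp Require Import all_boot all_order all_algebra.
From mathcomp Require Import all_classical all_reals all_analysis.
Set Implicit Arguments. Unset Strict Implicit. Unset Printing Implicit Defensive.
Import Order.TTheory GRing.Theory Num.Theory.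
Local Open Scope classical_set_scope.
Local Open Scope ring_scope.

Definition lpp (R : realType) (n : nat) (p : R) (v : 'cV[R]_n) : R :=
  \sum_(i < n) (`|v i 0| `^ p).

Definition nnz (R : realType) (n : nat) (v : 'cV[R]_n) : nat :=
  #|[set i : 'I_n | v i 0 != 0]|.

Definition unique_lp_min (R : realType) (m n : nat) (p : R)
    (A : 'M[R]_(m, n)) (x : 'cV[R]_n) : Prop :=
  (forall v : 'cV[R]_n, A *m v = A *m x -> lpp p x <= lpp p v) /\
  (forall v : 'cV[R]_n, A *m v = A *m x ->
     (forall w : 'cV[R]_n, A *m w = A *m x -> lpp p v <= lpp p w) -> v = x).

Definition mutually_independent d (T : measurableType d) (R : realType)
    (P : probability T R) (I : finType) (X : I -> {RV P >-> R}) : Prop :=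
  forall B : I -> set R, (forall i, measurable (B i)) ->
    P (\bigcap_(i in [set: I]) (X i @^-1` B i)) =
    (\prod_(i : I) P (X i @^-1` B i))%E.

Definition std_normal_RV d (T : measurableType d) (R : realType)
    (P : probability T R) (X : {RV P >-> R}) : Prop :=
  forall B : set R, measurable B -> P (X @^-1` B) = normal_prob 0 1 B.

Definition rand_mx d (T : measurableType d) (R : realType)
    (P : probability T R) (m n : nat) (X : 'I_m * 'I_n -> {RV P >-> R})
    (w : T) : 'M[R]_(m, n) := \matrix_(i, j) X (i, j) w.

(* Main.v *)
Require Import Defs.
From HB Require Import structures.
From mathcomp Require Import all_boot all_order all_algebra.
From mathcomp Require Import all_classical all_reals all_analysis.
From mathcomp Require Import measurable_realfun ring lra.
Import Order.TTheory GRing.Theory Num.Theory.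
Local Open Scope classical_set_scope.
Local Open Scope ring_scope.

(** Let N be the set of integer vectors z with |z_1| + ... + |z_n| <= 8n; it has
    at most 1024^n elements.  For fixed z, integrating out the Gaussian entries
    one at a time gives E exp (- t |A z|^2) = (1 + 2 t |z|^2)^(-m/2), so Markov's
    inequality and a union bound give a n |z|^2 <= |A z|^2 <= b n |z|^2 for all z
    in N outside an event of probability at most e^(-n), once a is small and b is
    large.  Rounding towards zero on a grid of mesh sqrt (|u|^2 / 8n) turns the
    upper bound into |A u|^2 <= 4 b n |u|^2 for all real u.  Finally, if h is in
    the kernel and its l_p mass is at least half on k <= rho n coordinates,
    then, since min (eta, |h_j|)^2 <= eta^(2-p) |h_j|^p, rounding h with mesh
    eta = th sqrt (|h|^2 / rho n) leaves a remainder r with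
    |r|^2 <= 4 th |h|^2, and a n |h - r|^2 <= |A (h - r)|^2 = |A r|^2 is
    contradictory for small th unless h = 0. *)

(** * One-dimensional Gaussian integrals *)

(** [normal_pdf] agrees almost everywhere with the Radon-Nikodym derivative of [normal_prob], both
    having the same integral over every measurable set. *)
Lemma ge0_integral_normal_prob (R : realType) (mean s : R) (f : R -> \bar R) :
  measurable_fun setT f -> (forall x, 0 <= f x)%E ->
  (\int[normal_prob mean s]_x f x =
   \int[lebesgue_measure]_x (f x * (normal_pdf mean s x)%:E))%E.
Proof.
move=> mf f0.
have dom := normal_prob_dominates mean s.
rewrite -(Radon_Nikodym_SigmaFinite.change_of_variables dom)//.
have intg := Radon_Nikodym_SigmaFinite.f_integrable dom.
have mg := measurable_int _ intg.
have mpdf : measurable_fun setT (fun x => (normal_pdf mean s x)%:E).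
  by apply/measurable_EFinP; exact: measurable_normal_pdf.
apply: ge0_ae_eq_integral => //.
- exact: emeasurable_funM.
- exact: emeasurable_funM.
- by move=> x _; rewrite mule_ge0// Radon_Nikodym_SigmaFinite.f_ge0.
- by move=> x _; rewrite mule_ge0// lee_fin normal_pdf_ge0.
apply: ae_eqe_mul2l.
apply: integral_ae_eq => // E _ mE.
by rewrite -(Radon_Nikodym_SigmaFinite.f_integral dom mE).
Qed.

Lemma measurable_expR_sqr (R : realType) (t c z : R) :
  measurable_fun [set: R] (fun x => expR (- t * (c + z * x) ^+ 2)).
Proof.
apply: measurableT_comp => //=; apply: measurable_funM => //=.
by apply: measurable_funX; exact: measurable_funD.
Qed.

(** Completing the square turns the integrand times the standard density into the right-hand
    constant times the normal density of mean [mean] and deviation [s], which has mass 1. Negative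
    [t] is allowed, as the upper tail requires. *)
Lemma integral_normal_expR_sqr (R : realType) (t c z : R) :
  0 < 1 + 2 * t * z ^+ 2 ->
  (\int[normal_prob 0 1]_x (expR (- t * (c + z * x) ^+ 2))%:E =
   ((Num.sqrt (1 + 2 * t * z ^+ 2))^-1 *
    expR (- (t / (1 + 2 * t * z ^+ 2)) * c ^+ 2))%:E)%E.
Proof.
move=> D0; set D := 1 + 2 * t * z ^+ 2 in D0 *.
have D0' : D != 0 by rewrite gt_eqF.
have sD0 : 0 < Num.sqrt D by rewrite sqrtr_gt0.
rewrite ge0_integral_normal_prob//; last first.
  by apply/measurable_EFinP; exact: measurable_expR_sqr.
pose s := (Num.sqrt D)^-1.
have s0 : s != 0 by rewrite gt_eqF// invr_gt0.
have ss : s ^+ 2 = D^-1 by rewrite /s exprVn sqr_sqrtr// ltW.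
(* From t (c + z x)^2 + x^2 / 2 = D (x - mean)^2 / 2 + t c^2 / D. *)
pose mean := - (2 * t * c * z / D).
rewrite -[RHS]mule1 -(integral_normal_pdf mean s).
rewrite -ge0_integralZl; first last.
- by rewrite lee_fin mulr_ge0 ?invr_ge0 ?expR_ge0// sqrtr_ge0.
- by move=> x _; rewrite lee_fin normal_pdf_ge0.
- by apply/measurable_EFinP; exact: measurable_normal_pdf.
- exact: measurableT.
apply: eq_integral => x _.
rewrite -!EFinM; congr EFin.
rewrite !normal_pdfE ?oner_eq0// /normal_fun.
have -> : normal_peak (1 : R) = normal_peak s * s.
  rewrite /normal_peak expr1n mul1r.
  rewrite -(mulrnAr (s ^+ 2)) sqrtrM ?sqr_ge0// sqrtr_sqr.
  rewrite gtr0_norm ?invr_gt0//.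
  by rewrite invfM mulrAC mulVf ?mul1r.
rewrite -/s; set e1 := expR _; set e2 := expR _; set e3 := expR _; set e4 := expR _.
suff E : e1 * e2 = e3 * e4.
  transitivity (normal_peak s * s * (e1 * e2)); first by ring.
  by rewrite E; ring.
rewrite /e1 /e2 /e3 /e4 -!expRD; congr expR.
by rewrite ss /mean /D; field.
Qed.

(** * Independence of one variable from all the others *)

(** The condition [B i = setT] leaves [X i] free; indexing by all of [I] lets [mutually_independent]
    apply once [B i] is replaced. *)
Definition cylinders_off (d : measure_display) (T : measurableType d)
    (R : realType) (P : probability T R) (I : finType) (X : I -> {RV P >-> R})
    (i : I) : set (set T) :=
  [set A | exists B : I -> set R, [/\ forall j, measurable (B j), B i = setT &
     A = \bigcap_(j in [set: I]) (X j @^-1` B j)]].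

(** The sample space under the coarser sigma-algebra generated by the variables other than [X i]; as
    a type it can be a factor of a product measure. *)
Definition sigma_off (d : measure_display) (T : measurableType d)
    (R : realType) (P : probability T R) (I : finType) (X : I -> {RV P >-> R})
    (i : I) := g_sigma_algebraType (cylinders_off d T R P I X i).

Section sigma_off_theory.
Context (d : measure_display) (T : measurableType d) (R : realType)
  (P : probability T R) (I : finType) (X : I -> {RV P >-> R}) (i : I).
Local Notation C := (cylinders_off d T R P I X i).
Local Notation T' := (sigma_off d T R P I X i).

Lemma cylinders_offI : setI_closed C.
Proof.
move=> _ _ [B [mB Bi ->]] [B' [mB' B'i ->]].
exists (fun j => B j `&` B' j); split.
- by move=> j; exact: measurableI.
- by rewrite Bi B'i setTI.
- by rewrite -bigcapI; apply: eq_bigcapr => j _; rewrite preimage_setI.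
Qed.

Lemma cylinders_offT : C setT.
Proof.
exists (fun=> setT); split => //.
by apply/esym; rewrite -subTset => w _ j _.
Qed.

Lemma measurable_cylinders_off : C `<=` measurable.
Proof.
move=> _ [B [mB _ ->]]; apply: fin_bigcap_measurable => // j _.
by rewrite -[_ @^-1` _]setTI; exact: measurable_funP.
Qed.

Lemma measurable_sigma_off_id : measurable_fun [set: T] (id : T -> T').
Proof.
move=> _ A mA; rewrite setTI preimage_id.
exact: (smallest_sub (@sigma_algebra_measurable _ T) measurable_cylinders_off).
Qed.

Lemma measurable_sigma_off_RV (j : I) : j != i ->
  measurable_fun [set: T'] (X j : T' -> R).
Proof.
move=> ji _ A mA; rewrite setTI; apply: sub_sigma_algebra.
exists (fun k => if k == j then A else setT); split.
- by move=> k; case: ifP.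
- by rewrite eq_sym (negbTE ji).
- apply/seteqP; split => [w wA k _ /=|w /(_ j Logic.I)/=]; last by rewrite eqxx.
  by case: eqP => // ->.
Qed.

Hypothesis indepX : mutually_independent X.

(** Both sides are finite measures in [B], a restriction and a multiple of [P], and they agree on
    the cylinders, which are closed under intersection. *)
Lemma independent_sigma_off (A : set R) (B : set T) : measurable A -> <<s C >> B ->
  P ((X i @^-1` A) `&` B) = (P (X i @^-1` A) * P B)%E.
Proof.
move=> mA sB; set D := X i @^-1` A.
have mD : measurable D by rewrite -[D]setTI; exact: measurable_funP.
have PDfin : P D \is a fin_num by rewrite fin_num_measure.
have r0 : 0 <= fine (P D) by rewrite fine_ge0.
have scaleE E : mscale (NngNum r0) P E = (P D * P E)%E.
  by rewrite /mscale /= fineK.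
rewrite setIC -scaleE -[LHS]/(mrestr P mD B).
apply: (g_sigma_algebra_measure_unique C measurable_cylinders_off
  (fun=> setT)) sB => //.
- by move=> _; exact: cylinders_offT.
- by rewrite -subTset => w _; exists 0%N.
- exact: cylinders_offI.
- move=> _ [B' [mB' B'i ->]]; rewrite [RHS]scaleE /= /mrestr setIC.
  pose B1 j := if j == i then A else B' j.
  have mB1 j : measurable (B1 j) by rewrite /B1; case: ifP.
  have -> : D `&` \bigcap_(j in [set: I]) (X j @^-1` B' j) =
     \bigcap_(j in [set: I]) (X j @^-1` B1 j).
    apply/seteqP; split => w /=.
      by move=> [wA wB] j _; rewrite /B1 /=; case: eqP => [->|_]; [|exact: wB].
    move=> wB; split; first by have := wB i Logic.I; rewrite /B1/= eqxx.
    move=> j _; have := wB j Logic.I; rewrite /B1/=.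
    by case: eqP => // -> _; rewrite B'i.
  rewrite !indepX// (bigD1 i)//= [in RHS](bigD1 i)//= /B1 eqxx.
  rewrite B'i preimage_setT probability_setT mul1e; congr (_ * _)%E.
  by apply: eq_bigr => j /negbTE ->.
- by move=> k; rewrite /= /mrestr setTI -ge0_fin_numE.
Qed.

(** Independence makes the joint law of [X i] and the identity into [T'] a product measure, so
    Tonelli lets [X i] be integrated first. With [w] itself as second argument, [f] may depend on
    all other variables at once. *)
Lemma ge0_integral_sigma_off (mu : probability (measurableTypeR R) R)
    (f : measurableTypeR R * T' -> \bar R) :
  (forall A, measurable A -> P (X i @^-1` A) = mu A) ->
  measurable_fun setT f -> (forall z, 0 <= f z)%E ->
  (\int[P]_w f (X i w, w) = \int[P]_w \int[mu]_x f (x, w))%E.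
Proof.
move=> lawX mf f0.
have mJ : measurable_fun [set: T] (fun w => (X i w, w) : measurableTypeR R * T').
  apply: measurable_fun_pair; last exact: measurable_sigma_off_id.
  exact: (@measurable_funPT _ _ _ _ (X i)).
pose J : {mfun T >-> (measurableTypeR R * T')%type} :=
  HB.pack (fun w => (X i w, w) : measurableTypeR R * T') (isMeasurableFun.Build _ _ _ _ _ mJ).
pose Y : {mfun T >-> T'} :=
  HB.pack (id : T -> T') (isMeasurableFun.Build _ _ _ _ _ measurable_sigma_off_id).
have JE : forall A, measurable A -> (mu \x distribution P Y)%E A = distribution P J A.
  move=> A mA; apply: (@product_measure_unique _ _ _ _ _ mu (distribution P Y)
    (distribution P J) _ A mA) => {mA}A B mA mB.
  transitivity (P (X i @^-1` A) * P B)%E; first exact: independent_sigma_off.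
  by congr (_ * _)%E; exact: lawX.
rewrite -[LHS](ge0_integral_distribution J)//.
transitivity (\int[mu \x distribution P Y]_z f z)%E.
  by apply: eq_measure_integral => A mA _; apply/esym/JE.
rewrite fubini_tonelli2//.
rewrite ge0_integral_distribution//.
  exact: measurable_fun_fubini_tonelli_G.
by move=> y; apply: integral_ge0.
Qed.
End sigma_off_theory.

Lemma measurable_sum_cond (d : measure_display) (T : measurableType d)
    (R : realType) (I : finType) (Q : pred I) (h : I -> T -> R) :
  (forall i, Q i -> measurable_fun setT (h i)) ->
  measurable_fun setT (fun w => \sum_(i | Q i) h i w).
Proof.
move=> mh.
have -> : (fun w => \sum_(i | Q i) h i w) =
    (fun w => \sum_i (if Q i then h i w else 0)).
  by apply/funext => w; rewrite big_mkcond.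
apply: measurable_sum => i; case: (boolP (Q i)) => [/mh|_] //.
Qed.

Lemma measurable_prod_cond (d : measure_display) (T : measurableType d)
    (R : realType) (I : finType) (Q : pred I) (h : I -> T -> R) :
  (forall i, Q i -> measurable_fun setT (h i)) ->
  measurable_fun setT (fun w => \prod_(i | Q i) h i w).
Proof.
move=> mh.
have -> : (fun w => \prod_(i | Q i) h i w) =
    (fun w => \prod_i (if Q i then h i w else 1)).
  by apply/funext => w; rewrite big_mkcond.
by apply: measurable_prod => i _; case: (boolP (Q i)) => [/mh|_] //.
Qed.

(** * The Laplace transform of |A z|^2 *)

Section gaussian_mgf.
Context (R : realType) (m n : nat) (d : measure_display) (T : measurableType d)
  (P : probability T R) (X : 'I_m * 'I_n -> {RV P >-> R}) (z : 'I_n -> R) (t : R).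

(* [F J] is the conditional expectation of exp (- t |A z|^2) given the entries
   outside [J]: each row carries its own rescaled coefficient t / D. *)
Let D (J : {set 'I_m * 'I_n}) (i : 'I_m) : R :=
  1 + 2 * t * \sum_(j | (i, j) \in J) z j ^+ 2.
Let Y (J : {set 'I_m * 'I_n}) (i : 'I_m) (w : T) : R :=
  \sum_(j | (i, j) \notin J) z j * X (i, j) w.
Let G (J : {set 'I_m * 'I_n}) (i : 'I_m) (w : T) : R :=
  (Num.sqrt (D J i))^-1 * expR (- (t / D J i) * (Y J i w) ^+ 2).
Let F (J : {set 'I_m * 'I_n}) (w : T) : R := \prod_i G J i w.

Hypothesis t_gt : 0 < 1 + 2 * t * \sum_j z j ^+ 2.

(** For [t < 0] the quantity decreases as [J] grows, so the worst case is a full row, which [t_gt]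
    covers. *)
Let D_gt0 J i : 0 < D J i.
Proof.
rewrite /D; set S := \sum_(j | _) _.
have S0 : 0 <= S by apply: sumr_ge0 => j _; exact: sqr_ge0.
have SS : S <= \sum_j z j ^+ 2.
  rewrite [leRHS](bigID (fun j => (i, j) \in J))/= lerDl.
  by apply: sumr_ge0 => j _; exact: sqr_ge0.
have [t0|t0] := leP 0 t.
  by rewrite ltr_wpDr ?ltr01// mulr_ge0// mulr_ge0.
apply: (lt_le_trans t_gt); rewrite lerD2l.
by rewrite ler_wnM2l// nmulr_lle0// ltW.
Qed.

Let G_ge0 J i w : 0 <= G J i w.
Proof. by rewrite mulr_ge0 ?expR_ge0// invr_ge0 sqrtr_ge0. Qed.

Hypothesis indepX : mutually_independent X.
Hypothesis normalX : forall ij, std_normal_RV (X ij).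

(** As a function of the entry [ij], the integrand is a constant times one Gaussian exponential; the
    one-variable formula with parameter t / D integrates it out and reproduces the same shape for
    the larger set. *)
Let F_step (J : {set 'I_m * 'I_n}) (ij : 'I_m * 'I_n) : ij \notin J ->
  (\int[P]_w (F J w)%:E = \int[P]_w (F (ij |: J)%SET w)%:E)%E.
Proof.
case: ij => i0 j0 ijJ; set J' := ((i0, j0) |: J)%SET.
pose T' := sigma_off d T R P _ X (i0, j0).
(* [c] skips the entry [(i0, j0)] and [K] involves only other rows, so both are measurable for
   [sigma_off]. *)
pose c (w : T') : R :=
  \sum_(j | ((i0, j) \notin J) && (j != j0)) z j * X (i0, j) w.
pose K (w : T') : R := (\prod_(i | i != i0) G J i w) * (Num.sqrt (D J i0))^-1.
pose f (x : measurableTypeR R * T') : \bar R :=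
  (K x.2 * expR (- (t / D J i0) * (c x.2 + z j0 * x.1) ^+ 2))%:E.
have K0 w : 0 <= K w.
  by rewrite mulr_ge0 ?invr_ge0 ?sqrtr_ge0//; apply: prodr_ge0 => i _; exact: G_ge0.
have YE w : Y J i0 w = c w + z j0 * X (i0, j0) w.
  by rewrite /Y (bigD1 j0)//= addrC.
have FJ w : (F J w)%:E = f (X (i0, j0) w, w).
  by rewrite /f /F (bigD1 i0)//= /G YE /K; congr EFin; rewrite mulrC mulrA.
have mX j : j != j0 -> forall i, measurable_fun [set: T'] (X (i, j) : T' -> R).
  by move=> jj0 i; apply: measurable_sigma_off_RV; rewrite xpair_eqE (negbTE jj0) andbF.
have mXi i : i != i0 -> forall j, measurable_fun [set: T'] (X (i, j) : T' -> R).
  by move=> ii0 j; apply: measurable_sigma_off_RV; rewrite xpair_eqE (negbTE ii0).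
have mc : measurable_fun [set: T'] c.
  apply: measurable_sum_cond => j /andP[_ jj0].
  by apply: measurable_funM => //; exact: mX.
have mK : measurable_fun [set: T'] K.
  apply: measurable_funM => //; apply: measurable_prod_cond => i ii0.
  apply: measurable_funM => //; apply: measurableT_comp => //.
  apply: measurable_funM => //; apply: measurable_funX.
  apply: measurable_sum_cond => j _.
  by apply: measurable_funM => //; exact: mXi.
have mf : measurable_fun setT f.
  apply/measurable_EFinP; apply: measurable_funM.
    by apply: (measurableT_comp mK); exact: measurable_snd.
  apply: measurableT_comp => //; apply: measurable_funM => //.
  apply: measurable_funX; apply: measurable_funD.
    by apply: (measurableT_comp mc); exact: measurable_snd.
  by apply: measurable_funM => //; exact: measurable_fst.
have f0 x : (0 <= f x)%E by rewrite lee_fin mulr_ge0 ?expR_ge0.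
transitivity (\int[P]_w f (X (i0, j0) w, w))%E.
  by apply: eq_integral => w _; rewrite FJ.
rewrite (ge0_integral_sigma_off _ _ _ _ _ _ _ indepX (normal_prob 0 1))//; last first.
  exact: normalX.
apply: eq_integral => w _.
have DE : D J' i0 = D J i0 + 2 * t * z j0 ^+ 2.
  rewrite /D (bigD1 j0) ?in_setU1 ?eqxx//= mulrDr addrA addrAC; congr (_ + _ * _ + _).
  apply: eq_bigl => j; rewrite in_setU1 xpair_eqE eqxx /=.
  by case: eqVneq => [->|]//=; rewrite ?andbT// (negbTE ijJ).
have DJ0 : D J i0 != 0 by rewrite gt_eqF.
have DJ'0 : D J' i0 != 0 by rewrite gt_eqF.
(* This ratio makes the normalising factors telescope from [D J i0] to [D J' i0]. *)
have ratioE : 1 + 2 * (t / D J i0) * z j0 ^+ 2 = D J' i0 / D J i0.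
  by rewrite DE; field.
have YJ' : Y J' i0 w = c w.
  apply: eq_bigl => j; rewrite in_setU1 xpair_eqE eqxx /= negb_or andbC.
  by [].
have GJ' i : i != i0 -> G J' i w = G J i w.
  move=> ii0; rewrite /G /D /Y.
  have inE' j : ((i, j) \in J') = ((i, j) \in J).
    by rewrite in_setU1 xpair_eqE (negbTE ii0).
  have -> : \sum_(j | (i, j) \in J') z j ^+ 2 = \sum_(j | (i, j) \in J) z j ^+ 2.
    by apply: eq_bigl => j; exact: inE'.
  have -> : \sum_(j | (i, j) \notin J') z j * X (i, j) w =
            \sum_(j | (i, j) \notin J) z j * X (i, j) w.
    by apply: eq_bigl => j; rewrite inE'.
  by [].
rewrite /f /=.
under eq_integral do rewrite EFinM.
rewrite ge0_integralZl//; first last.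
- by rewrite lee_fin.
- by apply/measurable_EFinP; exact: measurable_expR_sqr.
rewrite integral_normal_expR_sqr ratioE ?divr_gt0//.
rewrite -EFinM; congr EFin.
rewrite /F (bigD1 i0)//= {1}/G YJ' /K (eq_bigr _ GJ').
rewrite sqrtrM ?(ltW (D_gt0 _ _))// sqrtrV ?(ltW (D_gt0 _ _))//.
have sD : Num.sqrt (D J i0) != 0 by rewrite gt_eqF// sqrtr_gt0.
have sD' : Num.sqrt (D J' i0) != 0 by rewrite gt_eqF// sqrtr_gt0.
have -> : t / D J i0 / (D J' i0 / D J i0) = t / D J' i0 by field; apply/andP.
by field; apply/andP.
Qed.

(** For empty [J], [F] is the integrand; for full [J] it is a constant. [F_step] joins the two, by
    induction on the number of entries left. *)
Lemma gaussian_rows_mgf :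
  (\int[P]_w (expR (- t * \sum_i (\sum_j z j * X (i, j) w) ^+ 2))%:E =
   ((Num.sqrt (1 + 2 * t * \sum_j z j ^+ 2))^-1 ^+ m)%:E)%E.
Proof.
have FJ (k : nat) (J : {set 'I_m * 'I_n}) : #|(~: J)%SET| = k ->
    (\int[P]_w (F J w)%:E = \int[P]_w (F finset.setT w)%:E)%E.
  elim: k J => [|k IH] J Jk.
    have -> // : J = finset.setT.
    by rewrite -[J]finset.setCK (cards0_eq Jk) finset.setC0.
  have [ij] : exists ij, ij \in (~: J)%SET by apply/card_gt0P; rewrite Jk.
  rewrite finset.in_setC => ijJ; rewrite (F_step J ij ijJ); apply: IH.
  have := cardsD1 ij (~: J)%SET; rewrite Jk finset.in_setC ijJ add1n => -[->].
  by congr #|pred_of_set _|; rewrite finset.setCU finset.setIC -finset.setDE.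
have D0 i : D finset.set0 i = 1.
  by rewrite /D big1 ?mulr0 ?addr0// => j; rewrite finset.in_set0.
have DT i : D finset.setT i = 1 + 2 * t * \sum_j z j ^+ 2.
  by rewrite /D; congr (_ + _ * _); apply: eq_bigl => j; rewrite finset.in_setT.
have Y0 i w : Y finset.set0 i w = \sum_j z j * X (i, j) w.
  by apply: eq_bigl => j; rewrite finset.in_set0.
have YT i w : Y finset.setT i w = 0.
  by rewrite /Y big1// => j; rewrite finset.in_setT.
transitivity (\int[P]_w (F finset.set0 w)%:E)%E.
  apply: eq_integral => w _; congr EFin.
  rewrite /F mulr_sumr expR_sum; apply: eq_bigr => i _.
  by rewrite /G D0 Y0 sqrtr1 !invr1 mul1r mulr1.
rewrite (FJ _ _ erefl).
transitivity (\int[P]_w (cst ((Num.sqrt (1 + 2 * t * \sum_j z j ^+ 2))^-1 ^+ m)%:E w))%E.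
  apply: eq_integral => w _; congr EFin.
  rewrite -[m in RHS]card_ord -prodr_const; apply: eq_bigr => i _.
  by rewrite /G DT YT expr0n/= mulr0 expR0 mulr1.
by rewrite integral_cst//= probability_setT mule1.
Qed.
End gaussian_mgf.

(** * Exponential tail bounds *)

Lemma probability_le_integral (R : realType) (d : measure_display)
    (T : measurableType d) (P : probability T R) (A : set T) (g : T -> R) :
  measurable A -> measurable_fun setT g -> (forall w, 0 <= g w) ->
  (forall w, A w -> 1 <= g w) -> (P A <= \int[P]_w (g w)%:E)%E.
Proof.
move=> mA mg g0 g1.
have -> : P A = (\int[P]_w (\1_A w)%:E)%E by rewrite integral_indic// setIT.
apply: ge0_le_integral.
- exact: measurableT.
- by move=> w _; rewrite lee_fin.
- exact/measurable_EFinP/measurable_indic.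
- exact/measurable_EFinP.
move=> w _; rewrite lee_fin indicE; by case: (boolP (w \in A)) => [/set_mem/g1|].
Qed.

Section gaussian_tails.
Context (R : realType) (m n : nat) (d : measure_display) (T : measurableType d)
  (P : probability T R) (X : 'I_m * 'I_n -> {RV P >-> R}) (z : 'I_n -> R).
Hypothesis indepX : mutually_independent X.
Hypothesis normalX : forall ij, std_normal_RV (X ij).

Let S (w : T) : R := \sum_i (\sum_j z j * X (i, j) w) ^+ 2.
Let Q : R := \sum_j z j ^+ 2.

Lemma measurable_gaussian_rows :
  measurable_fun setT (fun w => \sum_i (\sum_j z j * X (i, j) w) ^+ 2).
Proof.
apply: measurable_sum => i; apply: measurable_funX; apply: measurable_sum => j.
by apply: measurable_funM => //; exact: measurable_funP.
Qed.

(** Markov's inequality for exp (L - t S), which is at least 1 on the event; positive [t] controls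
    the lower tail, negative [t] the upper one. *)
Lemma chernoff_gaussian_rows (t L : R) : 0 < 1 + 2 * t * Q ->
  (P [set w | (t * S w <= L)%R] <=
   (expR L * (Num.sqrt (1 + 2 * t * Q))^-1 ^+ m)%:E)%E.
Proof.
move=> tQ.
rewrite EFinM -(gaussian_rows_mgf _ _ _ _ _ _ X z t tQ indepX normalX).
have mS := measurable_gaussian_rows.
have mexp : measurable_fun setT (fun w => expR (- t * S w)).
  by apply: measurableT_comp => //; apply: measurable_funM.
rewrite -ge0_integralZl; first last.
- by rewrite lee_fin expR_ge0.
- by move=> w _; rewrite lee_fin expR_ge0.
- exact/measurable_EFinP.
- exact: measurableT.
under eq_integral do rewrite -EFinM.
apply: probability_le_integral.
- rewrite -[X in measurable X]setTI.
  have := measurable_fun_ler (measurable_funM (measurable_cst t) mS) (measurable_cst L).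
  by move=> /(_ measurableT [set true]); apply.
- exact: measurable_funM.
- by move=> w; rewrite mulr_ge0 ?expR_ge0.
move=> w /= tS; rewrite -expRD -[leLHS]expR0 ler_expR mulNr subr_ge0.
exact: tS.
Qed.

(** Taking t = s / |z|^2 makes the bound independent of [z]. *)
Lemma gaussian_rows_lower_tail (s a : R) : 0 < s -> 0 < Q ->
  (P [set w | (S w <= a * Q)%R] <=
   (expR (s * a) * (Num.sqrt (1 + 2 * s))^-1 ^+ m)%:E)%E.
Proof.
move=> s0 Q0.
have Q0' : Q != 0 by rewrite gt_eqF.
have E : 1 + 2 * (s / Q) * Q = 1 + 2 * s by field.
have := chernoff_gaussian_rows (s / Q) (s * a); rewrite E.
have -> : [set w | (s / Q * S w <= s * a)%R] = [set w | (S w <= a * Q)%R].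
  have EQ w : (s / Q * S w <= s * a) = (S w <= a * Q).
    by rewrite -mulrA ler_pM2l// mulrC ler_pdivrMr.
  by apply/seteqP; split => w /=; rewrite EQ.
by apply; lra.
Qed.

(** Taking t = - 1 / (4 |z|^2) gives 1 + 2 t |z|^2 = 1/2, and the resulting m-th power of sqrt 2 is
    at most e^m. *)
Lemma gaussian_rows_upper_tail (b : R) : 0 < Q ->
  (P [set w | (b * Q <= S w)%R] <= (expR (m%:R - b / 4))%:E)%E.
Proof.
move=> Q0.
have Q0' : Q != 0 by rewrite gt_eqF.
have E : 1 + 2 * (- (4 * Q)^-1) * Q = 2^-1 by field.
have := chernoff_gaussian_rows (- (4 * Q)^-1) (- (b / 4)); rewrite E.
have -> : [set w | (- (4 * Q)^-1 * S w <= - (b / 4))%R] = [set w | (b * Q <= S w)%R].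
  have EQ w : (- (4 * Q)^-1 * S w <= - (b / 4)) = (b * Q <= S w).
    rewrite mulNr lerN2 [X in (_ <= X) = _]mulrC ler_pdivlMr ?mulr_gt0//.
    by congr (_ <= _); field.
  by apply/seteqP; split => w /=; rewrite EQ.
rewrite invr_gt0 ltr0n => /(_ isT) /le_trans; apply.
rewrite lee_fin addrC expRD ler_pM2l ?expR_gt0//.
rewrite -[in leRHS](mul1r m%:R) mulrC expRM_natl lerXn2r ?nnegrE ?expR_ge0//.
rewrite sqrtrV// invrK.
apply: (@le_trans _ _ 2); last by have := expR_ge1Dx (1 : R); lra.
rewrite -[leRHS]ger0_norm// -sqrtr_sqr ler_sqrt//; lra.
Qed.
End gaussian_tails.

(** * Counting lattice points and rounding to them *)

(** Sign and absolute value are stored separately to get a finite type; zero has two codes, which an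
    upper bound on the count tolerates. *)
Definition lattice_pt (R : realType) (n N : nat)
    (f : {ffun 'I_n -> 'I_N.+1 * bool}) (j : 'I_n) : R :=
  (-1) ^+ (f j).2 * (f j).1%:R.

Definition lattice_ball (n N : nat) : {set {ffun 'I_n -> 'I_N.+1 * bool}} :=
  [set f : {ffun 'I_n -> 'I_N.+1 * bool} | (\sum_j (f j).1 <= N)%N]%SET.

Lemma sum_half_pow_le (R : realType) (N : nat) :
  \sum_(i < N) (2^-1 : R) ^+ i <= 2.
Proof.
have E : \sum_(i < N) (2^-1 : R) ^+ i = 2 - 2 * 2^-1 ^+ N.
  elim: N => [|N IH]; first by rewrite big_ord0 expr0; ring.
  by rewrite big_ord_recr/= IH exprS; field.
by rewrite E lerBlDr lerDl mulr_ge0// exprn_ge0// invr_ge0.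
Qed.

(* Weighting each coordinate by 2^-|z_j| turns the count into a product of
   geometric series. *)
Lemma card_lattice_ball (R : realType) (n N : nat) :
  #|lattice_ball n N|%:R <= 2 ^+ N * 4 ^+ n :> R.
Proof.
rewrite -sumr_const.
apply: (@le_trans _ _ (\sum_(f : {ffun 'I_n -> 'I_N.+1 * bool})
    2 ^+ N * \prod_j (2^-1 : R) ^+ (f j).1)).
  rewrite [leLHS]big_mkcond; apply: ler_sum => f _.
  have p0 : 0 <= 2 ^+ N * \prod_j (2^-1 : R) ^+ (f j).1.
    by rewrite mulr_ge0 ?exprn_ge0//; apply: prodr_ge0 => j _; rewrite exprn_ge0 ?invr_ge0.
  case: ifP => //; rewrite inE => fN.
  rewrite -(big_morph _ (exprD _) (expr0 _)) exprVn.
  rewrite ler_pdivlMr ?exprn_gt0// mul1r.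
  by rewrite ler_weXn2l// ler1n.
rewrite -mulr_sumr ler_pM2l ?exprn_gt0//.
rewrite -(bigA_distr_bigA (fun (_ : 'I_n) (x : 'I_N.+1 * bool) => (2^-1 : R) ^+ x.1)).
rewrite prodr_const card_ord lerXn2r ?nnegrE//.
  by apply: sumr_ge0 => x _; rewrite exprn_ge0 ?invr_ge0.
rewrite -(pair_bigA _ (fun (i : 'I_N.+1) (_ : bool) => (2^-1 : R) ^+ i))/=.
(* The two signs double a geometric series of sum at most 2, hence the factor 4 per coordinate. *)
under eq_bigr do rewrite sumr_const card_bool.
by rewrite sumrMnl; have := sum_half_pow_le R N.+1; lra.
Qed.

(** Rounding towards zero gives integers k_j <= |u_j| / eta. Since k <= k^2 for integers, their sum
    is at most |u|^2 / eta^2 <= N, so an l_1 ball suffices. *)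
Lemma lattice_rounding (R : realType) (n N : nat) (u : 'I_n -> R) (eta : R) :
  0 < eta -> \sum_j u j ^+ 2 <= N%:R * eta ^+ 2 ->
  exists2 f, f \in lattice_ball n N & forall j,
    [/\ (eta * lattice_pt R n N f j) ^+ 2 <= u j ^+ 2,
        (u j - eta * lattice_pt R n N f j) ^+ 2 <= eta ^+ 2 &
        (u j - eta * lattice_pt R n N f j) ^+ 2 <= u j ^+ 2].
Proof.
move=> eta0 uN.
pose k j := Num.truncn (`|u j| / eta).
have kP j : (k j)%:R <= `|u j| / eta < (k j).+1%:R.
  by apply: truncn_itv; rewrite divr_ge0// ltW.
have kl j : eta * (k j)%:R <= `|u j|.
  by have /andP[+ _] := kP j; rewrite ler_pdivlMr// mulrC.
have kr j : `|u j| < eta * (k j)%:R + eta.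
  by have /andP[_] := kP j; rewrite ltr_pdivrMr// -natr1 mulrDl mul1r mulrC.
have kk0 j : 0 <= eta * (k j)%:R by rewrite mulr_ge0// ltW.
have sumk : (\sum_j k j <= N)%N.
  rewrite -(ler_nat R) -(ler_pM2r (exprn_gt0 2 eta0)); apply: le_trans uN.
  rewrite natr_sum mulr_suml; apply: ler_sum => j _.
  apply: (@le_trans _ _ ((eta * (k j)%:R) ^+ 2)).
    rewrite exprMn mulrC ler_pM2l ?exprn_gt0// -natrX ler_nat.
    by case: (k j) => // i; rewrite -mulnn leq_pmulr.
  by rewrite -[leRHS]real_normK ?num_real// lerXn2r ?nnegrE.
have kN j : (k j < N.+1)%N.
  by rewrite ltnS (leq_trans _ sumk)// (bigD1 j)//= leq_addr.
pose f : {ffun 'I_n -> 'I_N.+1 * bool} := [ffun j => (Ordinal (kN j), u j < 0)].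
exists f.
  by rewrite inE; under eq_bigr do rewrite ffunE.
move=> j.
have fE : lattice_pt R n N f j = (-1) ^+ (u j < 0)%R * (k j)%:R.
  by rewrite /lattice_pt ffunE.
have uE : u j = (-1) ^+ (u j < 0)%R * `|u j| by rewrite -realEsign ?num_real.
have E1 : (eta * lattice_pt R n N f j) ^+ 2 = (eta * (k j)%:R) ^+ 2.
  by rewrite fE mulrCA exprMn sqrr_sign mul1r.
have E2 : u j - eta * lattice_pt R n N f j =
    (-1) ^+ (u j < 0)%R * (`|u j| - eta * (k j)%:R).
  by rewrite fE {1}uE mulrBr; congr (_ - _); rewrite mulrCA.
have uu : u j ^+ 2 = `|u j| ^+ 2 by rewrite real_normK ?num_real.
have E3 : (u j - eta * lattice_pt R n N f j) ^+ 2 = (`|u j| - eta * (k j)%:R) ^+ 2.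
  by rewrite E2 exprMn sqrr_sign mul1r.
rewrite E1 E3 uu; have := kl j; have := kr j; have := kk0 j.
move=> h1 h2 h3; split.
- by rewrite lerXn2r ?nnegrE.
- rewrite lerXn2r ?nnegrE ?subr_ge0//; first exact: ltW.
  by rewrite lerBlDl ltW.
- by rewrite lerXn2r ?nnegrE ?subr_ge0// lerBlDr lerDl.
Qed.

(** * Union bound over the lattice ball *)

Lemma probability_bigcap_ge (R : realType) (d : measure_display)
    (T : measurableType d) (P : probability T R) (I : choiceType) (r : seq I)
    (A : I -> set T) (eps : R) :
  (forall i, i \in r -> measurable (A i)) ->
  (forall i, i \in r -> (P (~` A i) <= eps%:E)%E) ->
  measurable (\bigcap_(i in [set` r]) A i) /\
  ((1 - (size r)%:R * eps)%:E <= P (\bigcap_(i in [set` r]) A i))%E.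
Proof.
move=> mA PA; rewrite bigcap_seq.
suff [mB PB] : measurable (\big[setI/setT]_(i <- r) A i) /\
    (P (~` \big[setI/setT]_(i <- r) A i) <= ((size r)%:R * eps)%:E)%E.
  split=> //; rewrite -[X in P X]setCK probability_setC; last exact: measurableC.
  by rewrite EFinB leeB.
elim: r mA PA => [|i r IH] mA PA.
  by rewrite big_nil setCT measure0 mul0r; split.
have [||mB PB] := IH.
- by move=> j jr; apply: mA; rewrite inE jr orbT.
- by move=> j jr; apply: PA; rewrite inE jr orbT.
rewrite big_cons; split.
  by apply: measurableI => //; apply: mA; rewrite mem_head.
rewrite setCI; apply: (le_trans (measureU2 _ _ _)).
- by apply: measurableC; apply: mA; rewrite mem_head.
- exact: measurableC.
rewrite /= -natr1 mulrDl mul1r addrC EFinD leeD//.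
by apply: PA; rewrite mem_head.
Qed.

Section lattice_event.
Context (R : realType) (m n : nat) (d : measure_display) (T : measurableType d)
  (P : probability T R) (X : 'I_m * 'I_n -> {RV P >-> R}).
Hypothesis indepX : mutually_independent X.
Hypothesis normalX : forall ij, std_normal_RV (X ij).

Lemma gaussian_rows_two_sided (z : 'I_n -> R) (s a b : R) : 0 < s ->
  let good := [set w | a * \sum_j z j ^+ 2 <=
      \sum_i (\sum_j z j * X (i, j) w) ^+ 2 <= b * \sum_j z j ^+ 2] in
  measurable good /\
  (P (~` good) <= (expR (s * a) * (Num.sqrt (1 + 2 * s))^-1 ^+ m +
                   expR (m%:R - b / 4))%:E)%E.
Proof.
move=> s0 good.
set Q := \sum_j z j ^+ 2 in good *.
pose S w := \sum_i (\sum_j z j * X (i, j) w) ^+ 2.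
have mS : measurable_fun setT S by exact: measurable_gaussian_rows.
have mle (c : R) : measurable [set w | S w <= c].
  rewrite -[X in measurable X]setTI.
  by have /(_ measurableT [set true]) := measurable_fun_ler mS (measurable_cst c); apply.
have mge (c : R) : measurable [set w | c <= S w].
  rewrite -[X in measurable X]setTI.
  by have /(_ measurableT [set true]) := measurable_fun_ler (measurable_cst c) mS; apply.
have goodE : good = [set w | a * Q <= S w] `&` [set w | S w <= b * Q].
  by apply/seteqP; split => w /=; [move/andP|move=> h; apply/andP].
have mgood : measurable good by rewrite goodE; exact: measurableI.
split=> //.
have Q0 : 0 <= Q by apply: sumr_ge0 => j _; exact: sqr_ge0.
have r0 : 0 <= expR (s * a) * (Num.sqrt (1 + 2 * s))^-1 ^+ m.
  by rewrite mulr_ge0 ?expR_ge0// exprn_ge0// invr_ge0 sqrtr_ge0.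
have [Qp|] := ltP 0 Q; last first.
  (* The tail bounds assume |z|^2 > 0; for z = 0 all three terms vanish and the bad event is
     empty. *)
  move=> Qn; have Qz : Q = 0 by apply/eqP; rewrite eq_le Qn.
  have z0 j : z j = 0.
    have : z j ^+ 2 = 0 by apply: (psumr_eq0P _ Qz) => // k _; exact: sqr_ge0.
    by move=> /eqP; rewrite sqrf_eq0 => /eqP.
  have -> : good = setT.
    rewrite -subTset => w _; rewrite /good /= Qz !mulr0.
    suff -> : \sum_i (\sum_j z j * X (i, j) w) ^+ 2 = 0 by rewrite lexx.
    rewrite big1// => i _; rewrite big1 ?expr0n// => j _.
    by rewrite z0 mul0r.
  by rewrite setCT measure0 lee_fin addr_ge0// expR_ge0.
have lo := gaussian_rows_lower_tail R m n d T P X z indepX normalX s a s0 Qp.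
have up := gaussian_rows_upper_tail R m n d T P X z indepX normalX b Qp.
rewrite EFinD; apply: (le_trans _ (leeD lo up)).
apply: (le_trans _ (measureU2 _ (mle _) (mge _))).
apply: le_measure.
- by rewrite inE; exact: measurableC.
- by rewrite inE; exact: measurableU.
- rewrite goodE setCI => w [] /= /negP; rewrite -ltNge => /ltW h; [by left|by right].
Qed.

Lemma gaussian_lattice_event (N : nat) (s a b : R) : 0 < s ->
  exists E : set T, [/\ measurable E,
    forall w f, E w -> f \in lattice_ball n N ->
      a * \sum_j lattice_pt R n N f j ^+ 2 <=
      \sum_i (\sum_j lattice_pt R n N f j * X (i, j) w) ^+ 2 <=
      b * \sum_j lattice_pt R n N f j ^+ 2 &
    ((1 - 2 ^+ N * 4 ^+ n * (expR (s * a) * (Num.sqrt (1 + 2 * s))^-1 ^+ m +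
                   expR (m%:R - b / 4)))%:E <= P E)%E].
Proof.
move=> s0; set eps := expR _ * _ + _.
have eps0 : 0 <= eps.
  by rewrite addr_ge0 ?expR_ge0// mulr_ge0 ?expR_ge0// exprn_ge0// invr_ge0 sqrtr_ge0.
have tw f := gaussian_rows_two_sided (lattice_pt R n N f) s a b s0.
have [mE PE] := probability_bigcap_ge R d T P _ (enum (lattice_ball n N)) _ eps
  (fun f _ => (tw f).1) (fun f _ => (tw f).2).
exists (\bigcap_(f in [set` enum (lattice_ball n N)])
  [set w | a * \sum_j lattice_pt R n N f j ^+ 2 <=
      \sum_i (\sum_j lattice_pt R n N f j * X (i, j) w) ^+ 2 <=
      b * \sum_j lattice_pt R n N f j ^+ 2]); split => //.
- by move=> w f Ew fN; apply: (Ew f); rewrite /= mem_enum.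
- apply: le_trans PE; rewrite lee_fin lerD2l lerN2 ler_wpM2r//.
  by rewrite -cardE; exact: card_lattice_ball.
Qed.
End lattice_event.

(** The ball of radius 8n has at most 2^(10n) <= e^(10n) points, so both tails are pushed below
    e^(-12n). *)
Lemma gaussian_lattice_isometry (R : realType) (alpha : R) : 0 < alpha < 1 ->
  exists a b : R, [/\ 0 < a, 0 < b & exists N : nat, forall n : nat, (N <= n)%N ->
  forall m : nat, Num.floor (alpha * n%:R) = m%:Z ->
  forall (d : measure_display) (T : measurableType d) (P : probability T R)
         (X : 'I_m * 'I_n -> {RV P >-> R}),
    mutually_independent X -> (forall ij, std_normal_RV (X ij)) ->
  exists E : set T, [/\ measurable E,
    forall w f, E w -> f \in lattice_ball n (8 * n) ->
      a * n%:R * \sum_j lattice_pt R n (8 * n) f j ^+ 2 <=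
      \sum_i (\sum_j lattice_pt R n (8 * n) f j * X (i, j) w) ^+ 2 <=
      b * n%:R * \sum_j lattice_pt R n (8 * n) f j ^+ 2 &
    ((1 - expR (- n%:R))%:E <= P E)%E]].
Proof.
move=> /andP[al0 al1].
(* [s] below satisfies 1 + 2 s = e^(2K), so each row contributes e^(-K); 26 ensures K m >= 13 n. *)
pose K := 26 / alpha.
have K0 : 0 < K by rewrite divr_gt0.
pose s := (expR K ^+ 2 - 1) / 2.
have eK : 1 < expR K by rewrite -expR0 ltr_expR.
have s0 : 0 < s by rewrite divr_gt0// subr_gt0 exprn_egt1.
(* With a = 1 / s the factor e^(s a n) costs only e^n, and b = 52 gives m - b n / 4 <= - 12 n. *)
exists s^-1, 52; split => //; first by rewrite invr_gt0.
(* Beyond this threshold alpha n > 2, so the floor still satisfies m >= alpha n / 2. *)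
exists (Num.truncn (2 / alpha)).+1 => n Nn m fm d T P X indepX normalX.
have n2 : 2 / alpha < n%:R :> R.
  apply: (lt_le_trans (truncnS_gt _)).
  by rewrite ler_nat.
have n1 : 1 <= n%:R :> R by rewrite ler1n (leq_trans _ Nn).
have mR : m%:R = (Num.floor (alpha * n%:R))%:~R :> R by rewrite fm.
have mle : m%:R <= alpha * n%:R by rewrite mR floor_le.
have mgt : alpha * n%:R - 1 < m%:R by rewrite mR ltrBlDr -intrD1 floorD1_gt.
have mn : m%:R <= n%:R :> R by apply: (le_trans mle); rewrite ler_piMl// ltW.
have Km : 13 * n%:R <= K * m%:R.
  have : 2 < alpha * n%:R by rewrite mulrC -ltr_pdivrMr.
  move=> h; have : alpha * n%:R / 2 <= m%:R by lra.
  move=> /(ler_wpM2l (ltW K0)); apply: le_trans.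
  by rewrite /K le_eqVlt; apply/orP; left; apply/eqP; field; rewrite gt_eqF.
have [E [mE HE PE]] := gaussian_lattice_event R m n d T P X indepX normalX
  (8 * n) s (s^-1 * n%:R) (52 * n%:R) s0.
exists E; split => //; apply: le_trans PE; rewrite lee_fin lerD2l lerN2.
have sE : (Num.sqrt (1 + 2 * s))^-1 = expR (- K).
  have -> : 1 + 2 * s = expR K ^+ 2 by rewrite /s; field.
  by rewrite sqrtr_sqr ger0_norm ?expR_ge0// expRN.
have e2 : 2 <= expR (1 : R) by have := expR_ge1Dx (1 : R); lra.
have cnt : 2 ^+ (8 * n) * 4 ^+ n <= expR (10 * n%:R) :> R.
  have -> : 2 ^+ (8 * n) * 4 ^+ n = 2 ^+ (10 * n) :> R.
    have -> : 4 = 2 ^+ 2 :> R by ring.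
    by rewrite -exprM -exprD -mulnDl.
  rewrite -[10 * n%:R]mulr1 -natrM expRM_natl.
  by rewrite lerXn2r ?nnegrE ?expR_ge0.
have t1 : expR (s * (s^-1 * n%:R)) * (Num.sqrt (1 + 2 * s))^-1 ^+ m <=
    expR (- (12 * n%:R)).
  rewrite sE mulrA divff ?gt_eqF// mul1r -expRM_natl -expRD ler_expR.
  by lra.
have t2 : expR (m%:R - 52 * n%:R / 4) <= expR (- (12 * n%:R)) :> R.
  by rewrite ler_expR; lra.
apply: (@le_trans _ _ (expR (10 * n%:R) * (2 * expR (- (12 * n%:R))))).
  by apply: ler_pM => //; lra.
(* The factor 2 from the two tails is absorbed by e^n, as n >= 1. *)
apply: (@le_trans _ _ (expR (10 * n%:R) * (expR n%:R * expR (- (12 * n%:R))))).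
  rewrite ler_pM2l ?expR_gt0// ler_pM2r ?expR_gt0//.
  by apply: (le_trans e2); rewrite ler_expR.
by rewrite -!expRD ler_expR; lra.
Qed.

(** * Inequalities for powers with exponent at most 1 *)

(** A ratio z / (x + y) in [0, 1] is at most its own p-th power; summing over z = x and z = y gives
    the claim. *)
Lemma powR_subadditive (R : realType) (p x y : R) : 0 < p <= 1 ->
  0 <= x -> 0 <= y -> (x + y) `^ p <= x `^ p + y `^ p.
Proof.
move=> /andP[p0 p1] x0 y0.
have [->|xn0] := eqVneq x 0.
  by rewrite add0r powR0 ?add0r// gt_eqF.
have xy0 : 0 < x + y by rewrite ltr_wpDr// lt_neqAle eq_sym xn0.
have key (z : R) : 0 <= z -> z <= x + y -> z / (x + y) * (x + y) `^ p <= z `^ p.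
  move=> z0 zxy; have [->|zn0] := eqVneq z 0; first by rewrite mul0r mul0r powR_ge0.
  have zp : 0 < z by rewrite lt_neqAle eq_sym zn0.
  have -> : z `^ p = (z / (x + y)) `^ p * (x + y) `^ p.
    by rewrite -powRM ?divr_ge0 ?(ltW xy0)// divfK ?gt_eqF.
  rewrite ler_wpM2r ?powR_ge0// ger1_powR// divr_gt0//=.
  by rewrite ler_pdivrMr// mul1r.
apply: (@le_trans _ _ (x / (x + y) * (x + y) `^ p + y / (x + y) * (x + y) `^ p)).
  by rewrite -mulrDl -mulrDl divff ?gt_eqF// mul1r.
by apply: lerD; apply: key => //; rewrite ?lerDl ?lerDr.
Qed.

Lemma powR_split_sqr (R : realType) (p x : R) : p <= 1 -> 0 <= x ->
  x `^ (2 - p) * x `^ p = x ^+ 2.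
Proof.
move=> p1 x0; rewrite -powRD; first by rewrite subrK powR_mulrn.
by rewrite subrK pnatr_eq0.
Qed.

(** Both exponents are nonnegative and add up to 2, so the product is at most the square of the
    larger of [l] and [h]. *)
Lemma powR_interpolation (R : realType) (p l h : R) : 0 < p <= 1 ->
  0 <= l -> 0 <= h -> l `^ (2 - p) * h `^ p <= l ^+ 2 + h ^+ 2.
Proof.
move=> /andP[p0 p1] l0 h0; have p2 : 0 <= 2 - p by lra.
have [hl|lh] := leP h l.
  apply: (@le_trans _ _ (l ^+ 2)); last by rewrite lerDl sqr_ge0.
  rewrite -(powR_split_sqr R p l p1 l0) ler_wpM2l ?powR_ge0//.
  by rewrite ge0_ler_powR// ltW.
apply: (@le_trans _ _ (h ^+ 2)); last by rewrite lerDr sqr_ge0.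
rewrite -(powR_split_sqr R p h p1 h0) ler_wpM2r ?powR_ge0//.
by rewrite ge0_ler_powR// ltW.
Qed.

(** In r^2 = r^(2-p) r^p, bound the first factor through [th * l] and the second through [h];
    th^(2-p) <= th because 2 - p >= 1. *)
Lemma sqr_le_powR (R : realType) (p th l h r : R) : 0 < p <= 1 ->
  0 < th <= 1 -> 0 <= l -> 0 <= h -> 0 <= r -> r <= th * l -> r <= h ->
  r ^+ 2 <= th * (l `^ (2 - p) * h `^ p).
Proof.
move=> /andP[p0 p1] th01 l0 h0 r0 rl rh; have p2 : 0 <= 2 - p by lra.
have /andP[th0 _] := th01.
rewrite -(powR_split_sqr R p r p1 r0) mulrA; apply: ler_pM; rewrite ?powR_ge0//.
  apply: (@le_trans _ _ ((th * l) `^ (2 - p))).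
    by rewrite ge0_ler_powR// nnegrE mulr_ge0// ltW.
  rewrite powRM ?(ltW th0)//; apply: ler_wpM2r; first exact: powR_ge0.
  by apply: ge1r_powR => //; lra.
by rewrite ge0_ler_powR// ltW.
Qed.

(** * From lattice points to kernel vectors, for a fixed matrix *)

Section lattice_isometry.
Context (R : realType) (m n : nat) (A : 'I_m -> 'I_n -> R) (a b : R).

Let q (u : 'I_n -> R) : R := \sum_j u j ^+ 2.
Let Q (u : 'I_n -> R) : R := \sum_i (\sum_j u j * A i j) ^+ 2.

Hypothesis n_gt0 : (0 < n)%N.
Hypotheses (a_gt0 : 0 < a) (b_gt0 : 0 < b).
Hypothesis isoA : forall f, f \in lattice_ball n (8 * n) ->
  a * n%:R * q (lattice_pt R n (8 * n) f) <= Q (lattice_pt R n (8 * n) f)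
    <= b * n%:R * q (lattice_pt R n (8 * n) f).

Let q_ge0 u : 0 <= q u.
Proof. by apply: sumr_ge0 => j _; exact: sqr_ge0. Qed.

Let Q_ge0 u : 0 <= Q u.
Proof. by apply: sumr_ge0 => j _; exact: sqr_ge0. Qed.

Let sum_split (u v : 'I_n -> R) i : \sum_j (u j + v j) * A i j =
  \sum_j u j * A i j + \sum_j v j * A i j.
Proof. by rewrite -big_split/=; apply: eq_bigr => j _; rewrite mulrDl. Qed.

Let Q_scale (c : R) u : Q (fun j => c * u j) = c ^+ 2 * Q u.
Proof.
rewrite /Q mulr_sumr; apply: eq_bigr => i _; rewrite -exprMn; congr (_ ^+ 2).
by rewrite mulr_sumr; apply: eq_bigr => j _; rewrite mulrA.
Qed.

Let q_scale (c : R) u : q (fun j => c * u j) = c ^+ 2 * q u.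
Proof. by rewrite /q mulr_sumr; apply: eq_bigr => j _; rewrite exprMn. Qed.

Let sqrD_le (x y : R) : (x + y) ^+ 2 <= 2 * x ^+ 2 + 2 * y ^+ 2.
Proof. by have := sqr_ge0 (x - y); rewrite !expr2; lra. Qed.

Let Q_add u v : Q (fun j => u j + v j) <= 2 * Q u + 2 * Q v.
Proof.
rewrite /Q !mulr_sumr -big_split/=; apply: ler_sum => i _.
by rewrite sum_split sqrD_le.
Qed.

(** A crude bound depending on [A], only meant to start the iteration. *)
Let Q_bounded : exists2 C : R, 0 <= C & forall u, Q u <= C * q u.
Proof.
exists (\sum_i (\sum_j `|A i j|) ^+ 2).
  by apply: sumr_ge0 => i _; exact: sqr_ge0.
move=> u; rewrite /Q mulr_suml; apply: ler_sum => i _.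
have uq j : `|u j| <= Num.sqrt (q u).
  rewrite -sqrtr_sqr ler_wsqrtr// /q (bigD1 j)//= lerDl.
  by apply: sumr_ge0 => k _; exact: sqr_ge0.
rewrite -[q u]sqr_sqrtr// -exprMn -[leLHS]real_normK ?num_real//.
rewrite lerXn2r ?nnegrE ?mulr_ge0 ?sqrtr_ge0//; first by apply: sumr_ge0.
apply: le_trans (ler_norm_sum _ _ _) _; rewrite mulr_suml; apply: ler_sum => j _.
by rewrite normrM mulrC ler_wpM2l.
Qed.

Let n0 : 0 < n%:R :> R. Proof. by rewrite ltr0n. Qed.

(* Each rounding step of mesh sqrt (q u / 8n) divides the squared length of the
   remainder by 8, so the a priori bound C is forgotten geometrically. *)
Let Q_iter (C : R) : 0 <= C -> (forall u, Q u <= C * q u) ->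
  forall k u, Q u <= (4 * b * n%:R + C * 4^-1 ^+ k) * q u.
Proof.
move=> C0 HC; elim=> [|k IH] u.
  rewrite expr0 mulr1; apply: (le_trans (HC u)); rewrite ler_wpM2r// lerDr.
  by rewrite mulr_ge0// mulr_ge0// ltW.
have [q0|q0] := eqVneq (q u) 0.
  by rewrite q0 mulr0; have := HC u; rewrite q0 mulr0.
have {}q0 : 0 < q u by rewrite lt_neqAle eq_sym q0 q_ge0.
pose eta := Num.sqrt (q u / (8 * n%:R)).
have d0 : 0 < q u / (8 * n%:R) by rewrite divr_gt0// mulr_gt0.
have eta0 : 0 < eta by rewrite sqrtr_gt0.
have eta2 : eta ^+ 2 = q u / (8 * n%:R) by rewrite sqr_sqrtr// ltW.
have [|f fN fP] := lattice_rounding R n (8 * n) u eta eta0.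
  by rewrite eta2 natrM mulrC divfK ?mulf_neq0// gt_eqF.
pose v j := eta * lattice_pt R n (8 * n) f j.
pose r j := u j - v j.
have Qu : Q u <= 2 * Q v + 2 * Q r.
  apply: le_trans (Q_add v r); rewrite le_eqVlt; apply/orP; left; apply/eqP.
  congr Q; apply/funext => j; by rewrite /r addrC subrK.
have Qv : Q v <= b * n%:R * q u.
  rewrite /v Q_scale; have /andP[_] := isoA f fN.
  move=> /(ler_wpM2l (sqr_ge0 eta)) h; apply: (le_trans h).
  rewrite mulrCA ler_wpM2l ?mulr_ge0// ?(ltW b_gt0)//.
  by rewrite -q_scale; apply: ler_sum => j _; have [] := fP j.
have qr : q r <= q u / 8.
  apply: (@le_trans _ _ (\sum_(j < n) eta ^+ 2)).
    by apply: ler_sum => j _; have [] := fP j.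
  rewrite sumr_const card_ord eta2 -mulr_natr le_eqVlt; apply/orP; left; apply/eqP.
  by field; rewrite gt_eqF.
have Qr := IH r; set x := C * 4^-1 ^+ k in Qr *.
have xE : C * 4^-1 ^+ k.+1 = x / 4 by rewrite /x exprS; field.
rewrite xE; set y := b * n%:R in Qv *.
have x0 : 0 <= x by rewrite mulr_ge0// exprn_ge0// invr_ge0.
have y0 : 0 <= y by rewrite mulr_ge0// ltW.
have h : (4 * b * n%:R + x) * q r <= (4 * y + x) * (q u / 8).
  by rewrite -mulrA -/y ler_wpM2l// addr_ge0// mulr_ge0.
have {}Qr := le_trans Qr h.
have yq : (4 * y + x) * (q u / 8) = y * q u / 2 + x * q u / 8 by field.
rewrite yq in Qr.
(* The recursion costs 2 y + 2 (4 y + x) / 8 = 3 y + x / 4, within 4 y + x / 4. *)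
have -> : (4 * b * n%:R + x / 4) * q u = 4 * (y * q u) + x * q u / 4.
  by rewrite /y; field.
have yq0 : 0 <= y * q u by rewrite mulr_ge0.
have xq0 : 0 <= x * q u by rewrite mulr_ge0.
by lra.
Qed.

(** The limit of [Q_iter] in [k]: a positive excess [e] would satisfy e 4^k <= C |u|^2 for all [k],
    contradicting k <= 4^k. *)
Lemma lattice_operator_bound u : Q u <= 4 * b * n%:R * q u.
Proof.
have [C C0 HC] := Q_bounded.
rewrite leNgt; apply/negP => lt.
set e := Q u - 4 * b * n%:R * q u.
have e0 : 0 < e by rewrite subr_gt0.
have H k : e <= C * q u * 4^-1 ^+ k.
  have := Q_iter C C0 HC k u; rewrite mulrDl -lerBlDl => /le_trans; apply.
  by rewrite mulrAC.
pose k := Num.truncn (C * q u / e).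
have : C * q u < e * k.+1%:R.
  by rewrite [ltRHS]mulrC -ltr_pdivrMr//; exact: truncnS_gt.
have k4 : k.+1%:R <= 4 ^+ k.+1 :> R.
  by rewrite -natrX ler_nat ltnW// ltn_expl.
have := H k.+1; rewrite exprVn ler_pdivlMr ?exprn_gt0//.
move=> h1 h2; have := lt_le_trans h2 (ler_wpM2l (ltW e0) k4).
by move=> /lt_le_trans/(_ h1); rewrite ltxx.
Qed.

Lemma lattice_null_space_property (p th : R) (S : {set 'I_n}) (h : 'I_n -> R) :
  0 < p <= 1 -> 0 < th <= 1 -> 4 * th * (a + 4 * b) < a / 2 ->
  #|S|%:R <= 8 * th ^+ 2 * n%:R -> (forall i, \sum_j h j * A i j = 0) ->
  \sum_(j | j \notin S) `|h j| `^ p <= \sum_(j in S) `|h j| `^ p ->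
  forall j, h j = 0.
Proof.
move=> p01 th01 thab Sn hA hS; have /andP[th0 th1] := th01.
suff q0 : q h = 0.
  move=> j; apply/eqP; rewrite -sqrf_eq0; apply/eqP.
  by apply: (psumr_eq0P _ q0) => // k _; exact: sqr_ge0.
apply/eqP; case: eqVneq => // qn0.
have {qn0}q0 : 0 < q h by rewrite lt_neqAle eq_sym qn0 q_ge0.
pose k := 8 * th ^+ 2 * n%:R.
have k0 : 0 < k by rewrite mulr_gt0// mulr_gt0// exprn_gt0.
(* The common size of [k] equal entries with total square |h|^2. With k = 8 th^2 n, the mesh
   [th * l] has square |h|^2 / 8n, exactly what rounding into the ball needs. *)
pose l := Num.sqrt (q h / k).
have l0 : 0 < l by rewrite sqrtr_gt0 divr_gt0.
have l2 : l ^+ 2 = q h / k by rewrite sqr_sqrtr// divr_ge0// ltW.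
pose W := l `^ (2 - p).
have W0 : 0 <= W by exact: powR_ge0.
have sumS : W * (\sum_(j in S) `|h j| `^ p) <= 2 * q h.
  apply: (@le_trans _ _ (\sum_(j in S) (l ^+ 2 + `|h j| ^+ 2))).
    rewrite mulr_sumr; apply: ler_sum => j _.
    by apply: powR_interpolation => //; exact: ltW.
  rewrite big_split/= sumr_const -[_ *+ #|S|]mulr_natr.
  have -> : 2 * q h = l ^+ 2 * k + q h by rewrite l2 divfK ?gt_eqF//; ring.
  apply: lerD; first by rewrite ler_wpM2l// sqr_ge0.
  rewrite /q [leRHS](bigID (fun j => j \in S))/=.
  under eq_bigr do rewrite real_normK ?num_real//.
  by rewrite lerDl; apply: sumr_ge0 => j _; exact: sqr_ge0.
have sumT : W * (\sum_j `|h j| `^ p) <= 4 * q h.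
  rewrite (bigID (fun j => j \in S))/= mulrDr.
  by have := ler_wpM2l W0 hS; lra.
pose eta := th * l.
have eta0 : 0 < eta by rewrite mulr_gt0.
have [|f fN fP] := lattice_rounding R n (8 * n) h eta eta0.
  rewrite /eta exprMn l2 /k -/(q h) natrM le_eqVlt; apply/orP; left; apply/eqP.
  by field; rewrite !gt_eqF.
pose v j := eta * lattice_pt R n (8 * n) f j.
pose r j := h j - v j.
have qr : q r <= 4 * th * q h.
  apply: (@le_trans _ _ (th * (W * (\sum_j `|h j| `^ p)))); last first.
    by rewrite [4 * th]mulrC -mulrA ler_wpM2l// ltW.
  rewrite 2!mulr_sumr; apply: ler_sum => j _.
  have [_ r1 r2] := fP j.
  rewrite -[leLHS]real_normK ?num_real//.
  apply: sqr_le_powR => //; first exact: ltW.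
    by rewrite -/eta -(ger0_norm (ltW eta0)) -ler_sqr ?nnegrE// !real_normK ?num_real.
  by rewrite -ler_sqr ?nnegrE// !real_normK ?num_real.
have qv : q h <= 2 * q v + 2 * q r.
  rewrite /q !mulr_sumr -big_split/=; apply: ler_sum => j _.
  have -> : h j = v j + r j by rewrite /r addrC subrK.
  exact: sqrD_le.
(* As A h = 0 and h = v + r, A v = - A r. *)
have Qvr : Q v = Q r.
  apply: eq_bigr => i _; rewrite -[RHS]sqrrN; congr (_ ^+ 2).
  apply/eqP; rewrite -addr_eq0 -sum_split.
  rewrite (eq_bigr (fun j => h j * A i j)) ?hA// => j _.
  by rewrite /r addrC subrK.
have Qv : a * n%:R * q v <= Q v.
  rewrite /v Q_scale q_scale mulrCA ler_wpM2l ?sqr_ge0//.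
  by have /andP[] := isoA f fN.
have : a * q v <= 4 * b * q r.
  rewrite -(ler_pM2l n0); have := lattice_operator_bound r; rewrite -Qvr.
  by move=> /(le_trans Qv); rewrite mulrA [n%:R * a]mulrC mulrA [n%:R * (4 * b)]mulrC.
move=> avr.
(* Chain: a |h|^2 / 2 <= a (|v|^2 + |r|^2) <= (a + 4 b) |r|^2 <= 4 th (a + 4 b) |h|^2 < a |h|^2 /
   2. *)
have h1 : a * (q h / 2) <= a * (q v + q r) by rewrite ler_pM2l//; lra.
have h2 : (a + 4 * b) * q r <= (a + 4 * b) * (4 * th * q h).
  by rewrite ler_wpM2l// addr_ge0// ltW// mulr_gt0.
have h3 : 4 * th * (a + 4 * b) * q h < a / 2 * q h by rewrite ltr_pM2r.
rewrite !mulrDr !mulrDl in h1 h2 h3.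
by nra.
Qed.

End lattice_isometry.

(** * Recovery by l_p minimization *)

(** For a competitor [v] put h = v - x. Off the support of [x], h = v; on it, |x_j|^p <= |v_j|^p +
    |h_j|^p. If [v] is no worse than [x], the mass of [h] off the support is at most that on it, so
    h = 0. *)
Lemma unique_lp_min_null_space (R : realType) (m n : nat) (p : R)
    (A : 'M[R]_(m, n)) (x : 'cV[R]_n) : 0 < p <= 1 ->
  (forall h : 'I_n -> R, (forall i, \sum_j h j * A i j = 0) ->
    \sum_(j | x j 0 == 0) `|h j| `^ p <= \sum_(j | x j 0 != 0) `|h j| `^ p ->
    forall j, h j = 0) ->
  unique_lp_min p A x.
Proof.
move=> p01 nsp; have /andP[p0 p1] := p01.
have strict (v : 'cV[R]_n) : A *m v = A *m x -> lpp p v <= lpp p x -> v = x.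
  move=> Avx vx; pose h j := v j 0 - x j 0.
  suff h0 j : h j = 0.
    by apply/matrixP => j k; rewrite ord1; apply/eqP; rewrite -subr_eq0; apply/eqP/h0.
  move: j; apply: nsp => [i|].
    rewrite (eq_bigr (fun j => A i j * v j 0 - A i j * x j 0)) => [|j _].
      by have /matrixP/(_ i 0) := Avx; rewrite !mxE sumrB => ->; rewrite subrr.
    by rewrite /h -mulrBr mulrC.
  move: vx; rewrite /lpp (bigID (fun j => x j 0 == 0))/=.
  rewrite [leRHS](bigID (fun j => x j 0 == 0))/= [X in _ <= X + _]big1; last first.
    by move=> j /eqP ->; rewrite normr0 powR0// gt_eqF.
  rewrite (eq_bigr (fun j => `|h j| `^ p)); last first.
    by move=> j /eqP xj; rewrite /h xj subr0.
  have : \sum_(j | x j 0 != 0) `|x j 0| `^ p <=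
      \sum_(j | x j 0 != 0) `|v j 0| `^ p + \sum_(j | x j 0 != 0) `|h j| `^ p.
    rewrite -big_split/=; apply: ler_sum => j _.
    apply: le_trans (powR_subadditive _ _ _ _ p01 (normr_ge0 _) (normr_ge0 _)).
    have xvh : `|x j 0| <= `|v j 0| + `|h j|.
      by rewrite -{1}(subKr (v j 0) (x j 0)); exact: ler_normB.
    by apply: ge0_ler_powR => //; rewrite ?nnegrE ?addr_ge0// ltW.
  by lra.
(* Uniqueness is immediate from [strict]; for minimality, a strictly better [v] would equal [x]. *)
split=> [v Avx|v Avx vmin]; last by apply: strict => //; exact: vmin.
rewrite leNgt; apply/negP => vx.
by move: (vx); rewrite (strict v Avx (ltW vx)) ltxx.
Qed.

Theorem theorem7 (R : realType) (alpha p : R) :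
  0 < alpha < 1 -> 0 < p <= 1 ->
  exists rho : R, exists c11 : R, 0 < rho /\ 0 < c11 /\
  exists N : nat, forall n : nat, (N <= n)%N ->
  forall m : nat, Num.floor (alpha * n%:R) = m%:Z ->
  forall (d : measure_display) (T : measurableType d) (P : probability T R)
         (X : 'I_m * 'I_n -> {RV P >-> R}),
    mutually_independent X -> (forall ij, std_normal_RV (X ij)) ->
    exists E : set T, measurable E /\
      E `<=` [set w | forall x : 'cV[R]_n, (nnz x)%:R <= rho * n%:R ->
                        unique_lp_min p (rand_mx X w) x] /\
      ((1 - expR (- (c11 * n%:R)))%:E <= P E)%E.
Proof.
move=> al01 p01.
have [a [b [a0 b0 [N HN]]]] := gaussian_lattice_isometry R alpha al01.
(* Chosen so that 4 th (a + 4 b) = a / 4. Since [a] and [b] come from [alpha] alone, one [rho]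
   serves every [p]. *)
pose th := a / (16 * (a + 4 * b)).
have ab0 : 0 < a + 4 * b by rewrite addr_gt0// mulr_gt0.
have th0 : 0 < th by rewrite divr_gt0// mulr_gt0.
have th1 : th <= 1 by rewrite ler_pdivrMr ?mulr_gt0//; lra.
have thab : 4 * th * (a + 4 * b) < a / 2.
  have -> : 4 * th * (a + 4 * b) = a / 4 by rewrite /th; field; rewrite gt_eqF.
  by lra.
exists (8 * th ^+ 2), 1; split; first by rewrite mulr_gt0// exprn_gt0.
split=> //; exists (maxn N 1) => n; rewrite geq_max => /andP[Nn n0] m fm d T P X iX nX.
have [E [mE HE PE]] := HN n Nn m fm d T P X iX nX.
exists E; split=> //; split; last by rewrite mul1r.
move=> w Ew x xn; apply: unique_lp_min_null_space => // h hA hS.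
apply: (lattice_null_space_property R m n (fun i j => X (i, j) w) a b n0 a0 b0
  (fun f fN => HE w f Ew fN) p th [set j | x j 0 != 0]%SET h) => //.
- exact/andP.
- apply: le_trans xn; rewrite ler_nat; apply: eq_leq.
  rewrite /nnz; apply: eq_card => j.
  by rewrite finset.inE; apply/idP/idP => [xj|]; [exact: mem_set|exact: set_mem].
- by move=> i; rewrite -[RHS](hA i); apply: eq_bigr => j _; rewrite mxE.
- rewrite (eq_bigl (fun j => x j 0 == 0)); last by move=> j; rewrite inE negbK.
  by rewrite [leRHS](eq_bigl (fun j => x j 0 != 0))// => j; rewrite inE.
Qed.
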